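(* Let $\mu>0$, let $$\omega=[-1,1]\cup\bigcup_{n\ge1}\big((n^2,n^2+n)\cup(-n^2-n,-n^2)\big)\subset\mathbb{R},$$ and let $\omega(t)=\sqrt{1+2\mu t}\;\omega=\{\sqrt{1+2\mu t}\,y:\ y\in\omega\}$ for $t\ge0$. For all $T>0$, there exist positive constants $r,\delta>0$ such that $$\forall x\in\mathbb{R},\quad\int_0^T\lambda\big((x-r,x+r)\cap\omega(t)\big)\,dt\ge\delta>0.$$
   Context: $\lambda$ denotes the Lebesgue measure on $\mathbb{R}$. *)

(* Defs.v *)
From mathcomp Require Import all_boot all_order all_algebra.
From mathcomp Require Import all_classical all_reals all_analysis.
Set Implicit Arguments.
Unset Strict Implicit.
Unset Printing Implicit Defensive.
Import Order.TTheory GRing.Theory Num.Theory.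
Import numFieldNormedType.Exports.
Local Open Scope classical_set_scope.
Local Open Scope ring_scope.

Definition omega {R : realType} : set R :=
  `[-1, 1] `|`
  \bigcup_(n in [set n : nat | (1 <= n)%N])
    (`](n%:R ^+ 2), (n%:R ^+ 2 + n%:R)[ `|`
     `](- (n%:R ^+ 2) - n%:R), (- (n%:R ^+ 2))[).

Definition omega_at {R : realType} (mu t : R) : set R :=
  [set Num.sqrt (1 + 2 * mu * t) * y | y in omega].

(* Main.v *)
(** Since omega(t) contains [-1, 1], a window of large radius handles bounded x.
    For large |x|, let tau(a) be the time at which the point a of omega has been
    dilated to |x|.  Whenever tau(n^2 + n) < t < tau(n^2), the point x lies in a
    component of omega(t) of length at least 1, so the integrand is at least 1.
    As tau is convex, these times make up at least a third of
    (tau((n+1)^2), tau(n^2)), and summing over N <= n < M telescopes to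
    (tau(N^2) - tau(M^2)) / 3.  With rho^8 = 1 + 2 mu T, squares N^2 in
    [|x|/rho^4, |x|/rho^3] and M^2 in [|x|/rho, |x|] exist for large |x|, which
    bounds this difference from below independently of x. *)
Require Import Defs.
From mathcomp Require Import all_boot all_order all_algebra.
From mathcomp Require Import all_classical all_reals all_analysis.
From mathcomp Require Import ring lra.
Import Order.TTheory GRing.Theory Num.Theory.
Import numFieldNormedType.Exports.
Local Open Scope classical_set_scope.
Local Open Scope ring_scope.

(** * Measurability, and lower bounds for integrals and window measures *)

Lemma measurable_omega (R : realType) : measurable (@omega R).
Proof.
apply: measurableU => //; apply: bigcup_measurable => n _.
by apply: measurableU.
Qed.

Lemma measurable_omega_at (R : realType) (mu t : R) :
  0 <= mu -> 0 <= t -> measurable (omega_at mu t).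
Proof.
move=> mu0 t0; have s0 : 0 < Num.sqrt (1 + 2 * mu * t).
  by rewrite sqrtr_gt0 ltr_pwDl// !mulr_ge0.
have -> : omega_at mu t =
    ( *%R (Num.sqrt (1 + 2 * mu * t))^-1) @^-1` omega.
  apply/seteqP; split => [_ [y oy <-] /=|y /= oy].
    by rewrite mulKf ?gt_eqF.
  by exists ((Num.sqrt (1 + 2 * mu * t))^-1 * y); rewrite ?mulVKf ?gt_eqF.
rewrite -[X in measurable X]setTI.
by apply: (measurable_realfun.mulrl_measurable _) => //; exact: measurable_omega.
Qed.

(** The integral of a nonnegative function is a supremum over the simple functions below it, and
    each one below the indicator of [E] is below [f] on [D]. This applies to the window measure as a
    function of time without studying its regularity in [t]. *)
Lemma le_measure_integral_ge1 (d : measure_display) (T : measurableType d)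
    (R : realType) (mu : {measure set T -> \bar R}) (D E : set T)
    (f : T -> \bar R) :
  measurable D -> measurable E -> E `<=` D ->
  (forall x, D x -> 0 <= f x)%E -> (forall x, E x -> 1 <= f x)%E ->
  (mu E <= \int[mu]_(x in D) f x)%E.
Proof.
move=> mD mE ED f0 f1.
rewrite -[E in mu E](setIidl ED) -integral_indic//.
rewrite ge0_integralE; last by move=> x _; rewrite lee_fin.
rewrite ge0_integralE//.
apply: ereal_sup_le => _ [h /= hE <-]; exists h => // x /=.
apply: le_trans (hE x) _; rewrite !patchE.
case: ifPn => // /set_mem Dx.
rewrite indicE; have [/set_mem/f1//|_] := boolP (x \in E).
exact: f0.
Qed.

Lemma window_measure_ge1 (R : realType) (A : set R) (r a b x : R) :
  measurable A -> 1 <= r -> a + 1 <= b -> a <= x <= b -> `]a, b[ `<=` A ->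
  (1 <= @lebesgue_measure R (`](x - r)%R, (x + r)%R[ `&` A))%E.
Proof.
move=> mA r1 ab /andP[ax xb] abA.
(* Cutting []a, b[] at distance 1 from [x] keeps it inside the window, and leaves length at least 1
   because [x] lies between [a] and [b]. *)
pose l := Num.max a (x - 1); pose u := Num.min b (x + 1).
have lu : l + 1 <= u.
  rewrite /l /u -lerBrDr ge_max -!lerBrDr !lerBrDr !le_min.
  by apply/andP; split; apply/andP; split; lra.
apply: (@le_trans _ _ (lebesgue_measure (`]l, u[ : set R))).
  rewrite lebesgue_measure_itv /= lte_fin (_ : l < u); last by lra.
  by rewrite -EFinD lee_fin; lra.
apply: le_measure; rewrite ?inE//.
  by apply: measurableI.
move=> y /=; rewrite !in_itv /= gt_max lt_min => /andP[/andP[ay xy] /andP[yb yx]].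
split; first by apply/andP; split; lra.
by apply: abA; rewrite /= in_itv /= ay.
Qed.

(** * Squares in geometric windows *)

Lemma exists_square_between (R : realType) (rho : R) : 1 < rho ->
  exists2 Y : R, 1 <= Y & forall y, Y <= y ->
    exists2 n : nat, (0 < n)%N & y <= n%:R ^+ 2 <= rho * y.
Proof.
(* With [q] the root of [y], the next square is at most [(q + 1) ^+ 2], and
   [2 * q + 1 <= 3 * q <= (rho - 1) * q ^+ 2] as soon as [q >= c]. *)
move=> rho1; pose c := 1 + 3 / (rho - 1).
have c1 : 1 <= c by rewrite lerDl divr_ge0// subr_ge0 ltW.
exists (c ^+ 2) => [|y Yy]; first by rewrite expr_ge1 // (le_trans _ c1).
have y0 : 0 <= y by apply: le_trans Yy; rewrite sqr_ge0.
have cy : c <= Num.sqrt y.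
  by rewrite -(@ler_pXn2r _ 2) ?nnegrE ?sqrtr_ge0 ?sqr_sqrtr// (le_trans _ c1).
have /truncn_itv/andP[ny yn] := sqrtr_ge0 y.
exists (Num.truncn (Num.sqrt y)).+1 => //.
have hy := sqr_sqrtr y0.
move: cy ny yn hy; set q := Num.sqrt y; set m := Num.truncn q => cy mq qm <-.
have : (rho - 1) * c = rho + 2 by rewrite /c; field; rewrite gt_eqF; lra.
rewrite -natr1 in qm *; move=> hc.
have m0 : 0 <= m%:R :> R by [].
apply/andP; split; first by nra.
have q1 : 1 <= q := le_trans c1 cy.
have : (rho - 1) * c * q <= (rho - 1) * q * q.
  by rewrite ler_wpM2r ?ler_wpM2l//; lra.
rewrite hc => hq.
have : (m%:R + 1) ^+ 2 <= (q + 1) ^+ 2 by nra.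
have : q <= rho * q by rewrite ler_peMl; lra.
by lra.
Qed.

(** * Passage times and the times at which a component covers a point *)

(* The time at which the dilated point [sqrt (1 + 2 mu t) * a] passes [x]. *)
Definition passage_time {R : realType} (mu x a : R) : R :=
  ((x / a) ^+ 2 - 1) / (2 * mu).

Lemma passage_time_le (R : realType) (mu x a b : R) :
  0 < mu -> 0 < a -> a <= b -> passage_time mu x b <= passage_time mu x a.
Proof.
move=> mu0 a0 ab; have b0 := lt_le_trans a0 ab.
rewrite ler_pM2r ?invr_gt0 ?mulr_gt0// lerD2r !exprMn ler_wpM2l ?sqr_ge0//.
by rewrite lerXn2r ?nnegrE ?invr_ge0 ?(ltW a0) ?(ltW b0)// lef_pV2.
Qed.

Lemma lt_passage_time (R : realType) (mu x a t : R) :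
  0 < mu -> 0 <= t -> 0 < a -> 0 < x ->
  (t < passage_time mu x a) = (Num.sqrt (1 + 2 * mu * t) * a < x).
Proof.
move=> mu0 t0 a0 x0.
have s0 : 0 <= 1 + 2 * mu * t by rewrite addr_ge0// !mulr_ge0// ltW.
rewrite ltr_pdivlMr ?mulr_gt0// -[RHS]ltr_pdivlMr// ltrBrDl (mulrC t).
rewrite -[RHS](@ltr_pXn2r _ 2) ?nnegrE ?sqrtr_ge0 ?divr_ge0 ?ltW//.
by rewrite sqr_sqrtr.
Qed.

Lemma passage_time_lt (R : realType) (mu x a t : R) :
  0 < mu -> 0 <= t -> 0 < a -> 0 < x ->
  (passage_time mu x a < t) = (x < Num.sqrt (1 + 2 * mu * t) * a).
Proof.
move=> mu0 t0 a0 x0.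
have s0 : 0 <= 1 + 2 * mu * t by rewrite addr_ge0// !mulr_ge0// ltW.
rewrite ltr_pdivrMr ?mulr_gt0// -[RHS]ltr_pdivrMr// ltrBlDl (mulrC t).
rewrite -[RHS](@ltr_pXn2r _ 2) ?nnegrE ?sqrtr_ge0 ?divr_ge0 ?ltW//.
by rewrite sqr_sqrtr.
Qed.

(** Put A = (n+1)^2 and B = n^2. Then (n^2 + n)^2 = A B, so up to the common factor x^2 (A - B) / (2
    mu A^2 B^2) the two differences are A + B and A, and the claim becomes 2 A - B >= 0. *)
Lemma passage_time_filled (R : realType) (mu x : R) (n : nat) :
  0 < mu -> (0 < n)%N ->
  (passage_time mu x (n%:R ^+ 2) - passage_time mu x (n.+1%:R ^+ 2)) / 3 <=
  passage_time mu x (n%:R ^+ 2) - passage_time mu x (n%:R ^+ 2 + n%:R).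
Proof.
move=> mu0; rewrite -(ltr_nat R) -natr1 => n0.
set v : R := n%:R in n0 *; rewrite -subr_ge0.
have v1 : 0 < v + 1 by lra.
have -> : passage_time mu x (v ^+ 2) - passage_time mu x (v ^+ 2 + v) -
    (passage_time mu x (v ^+ 2) - passage_time mu x ((v + 1) ^+ 2)) / 3 =
    (x ^+ 2 / (6 * mu) / (v ^+ 4 * (v + 1) ^+ 4)) *
    ((2 * (v + 1) ^+ 2 - v ^+ 2) * ((v + 1) ^+ 2 - v ^+ 2)).
  rewrite /passage_time; field.
  by rewrite !gt_eqF//; nra.
apply: mulr_ge0; last by apply: mulr_ge0; nra.
by rewrite !divr_ge0 ?sqr_ge0 ?mulr_ge0 ?exprn_ge0 ?(ltW n0) ?(ltW v1) ?(ltW mu0).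
Qed.

Lemma filled_interval_le (R : realType) (n M : nat) :
  (n < M)%N -> n%:R ^+ 2 + n%:R <= M%:R ^+ 2 :> R.
Proof.
move=> nM.
by rewrite -!natrX -natrD ler_nat -!mulnn addnC -mulnS leq_mul// ltnW.
Qed.

Lemma filled_times (R : realType) (mu x : R) (N M : nat) :
  0 < mu -> (0 < N)%N -> (N <= M)%N ->
  exists E : set R, [/\ measurable E,
    (((passage_time mu x (N%:R ^+ 2) - passage_time mu x (M%:R ^+ 2)) / 3)%:E
      <= @lebesgue_measure R E)%E &
    forall t, E t -> exists2 n, (N <= n < M)%N &
      passage_time mu x (n%:R ^+ 2 + n%:R) < t < passage_time mu x (n%:R ^+ 2)].
Proof.
move=> mu0 N0; elim: M => [|M IH]; first by case: N N0.
rewrite leq_eqVlt => /predU1P[<-|]; first by exists set0; rewrite measure0 subrr mul0r; split.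
rewrite ltnS => NM; have [E [mE lE EP]] := IH NM.
have M0 : (0 < M)%N := leq_trans N0 NM.
(* Passage times decrease in [a], so the interval added for [M] ends before [E] begins; the union is
   disjoint and the measures add. *)
have ME t : E t -> passage_time mu x (M%:R ^+ 2) < t.
  move=> /EP[n /andP[Nn nM] /andP[nt _]]; apply: le_lt_trans nt.
  have n0 : (0 < n)%N := leq_trans N0 Nn.
  apply: passage_time_le; [by []|by rewrite ltr_pwDl ?exprn_gt0 ?ltr0n|].
  exact: filled_interval_le.
pose I := `]passage_time mu x (M%:R ^+ 2 + M%:R), passage_time mu x (M%:R ^+ 2)[%classic : set R.
have mI : measurable I by exact: measurable_itv.
exists (E `|` I); split.
- exact: measurableU.
- rewrite measureU//; last first.
    apply/seteqP; split => // t [/ME Mt]; rewrite /I /= in_itv /= => /andP[_].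
    by move=> /(lt_trans Mt); rewrite ltxx.
  have hf := passage_time_filled _ _ x _ mu0 M0.
  have -> : (passage_time mu x (N%:R ^+ 2) - passage_time mu x (M.+1%:R ^+ 2)) / 3 =
    (passage_time mu x (N%:R ^+ 2) - passage_time mu x (M%:R ^+ 2)) / 3 +
    (passage_time mu x (M%:R ^+ 2) - passage_time mu x (M.+1%:R ^+ 2)) / 3 by lra.
  rewrite EFinD; apply: leeD => //.
  suff : (((passage_time mu x (M%:R ^+ 2) - passage_time mu x (M.+1%:R ^+ 2)) / 3)%:E
      <= @lebesgue_measure R I)%E by [].
  (* If [I] is empty (as for [x = 0]), its measure is 0, and [hf] makes the left side
     nonpositive. *)
  rewrite /I lebesgue_measure_itv /= lte_fin; case: ifPn => [_|].
    by rewrite -EFinD lee_fin.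
  by rewrite -leNgt lee_fin; lra.
- move=> t [/EP[n /andP[Nn nM] nt]|].
    by exists n => //; rewrite Nn ltnS ltnW.
  by rewrite /I /= in_itv /= => Mt; exists M => //; rewrite NM ltnSn.
Qed.

(** * Lower bounds for the integrand at a fixed time *)

Lemma window_omega_at_ge1 (R : realType) (mu t r x : R) (n : nat) :
  0 < mu -> 0 <= t -> 1 <= r -> x != 0 -> (0 < n)%N ->
  passage_time mu `|x| (n%:R ^+ 2 + n%:R) < t < passage_time mu `|x| (n%:R ^+ 2) ->
  (1 <= @lebesgue_measure R (`](x - r)%R, (x + r)%R[ `&` omega_at mu t))%E.
Proof.
move=> mu0 t0 r1 x0 n0; rewrite -normr_gt0 in x0.
have n1 : 1 <= n%:R :> R by rewrite ler1n.
have n2 : 0 < n%:R ^+ 2 :> R by nra.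
have nn : 0 < n%:R ^+ 2 + n%:R :> R by lra.
rewrite passage_time_lt// lt_passage_time//.
have mA := @measurable_omega_at R mu t (ltW mu0) t0.
have s1 : 1 <= Num.sqrt (1 + 2 * mu * t).
  by rewrite -[leLHS]sqrtr1 ler_wsqrtr// lerDl !mulr_ge0// ltW.
move: s1 mA; rewrite /omega_at; set s := Num.sqrt _ => s1 mA /andP[xb ax].
have s0 : 0 < s by lra.
(* Passage times see only the absolute value of [x]; a negative [x] lies in the mirrored component.
   Either component has length [s * n%:R >= 1]. *)
case: (ler0P x) xb ax => [xle|xgt] xb ax.
- apply: (@window_measure_ge1 _ _ _ (- (s * (n%:R ^+ 2 + n%:R))) (- (s * n%:R ^+ 2))) => //.
  + nra.
  + by apply/andP; split; lra.
  + move=> y /=; rewrite in_itv /= => /andP[ya yb].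
    exists (s^-1 * y); last by rewrite mulVKf ?gt_eqF.
    right; exists n => //; right; rewrite /= in_itv /=.
    by rewrite ltr_pdivlMl// ltr_pdivrMl// mulrN mulrBr mulrN mulrDr in ya *;
      apply/andP; split; lra.
- apply: (@window_measure_ge1 _ _ _ (s * n%:R ^+ 2) (s * (n%:R ^+ 2 + n%:R))) => //.
  + nra.
  + by apply/andP; split; lra.
  + move=> y /=; rewrite in_itv /= => /andP[ya yb].
    exists (s^-1 * y); last by rewrite mulVKf ?gt_eqF.
    right; exists n => //; left; rewrite /= in_itv /=.
    by rewrite ltr_pdivlMl// ltr_pdivrMl// ya.
Qed.

Lemma window_near0_omega_at_ge1 (R : realType) (mu t r x : R) :
  0 <= mu -> 0 <= t -> `|x| + 1 <= r ->
  (1 <= @lebesgue_measure R (`](x - r)%R, (x + r)%R[ `&` omega_at mu t))%E.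
Proof.
move=> mu0 t0 xr; have mA := @measurable_omega_at R mu t mu0 t0.
have s1 : 1 <= Num.sqrt (1 + 2 * mu * t).
  by rewrite -[leLHS]sqrtr1 ler_wsqrtr// lerDl !mulr_ge0.
apply: (@le_trans _ _ (lebesgue_measure (`]-1, 1[ : set R))).
  rewrite lebesgue_measure_itv /= lte_fin (_ : -1 < 1); last by lra.
  by rewrite -EFinD lee_fin; lra.
have := ler_norm x; have := ler_norm (- x); rewrite normrN => nx px.
apply: le_measure; rewrite ?inE//; first exact: measurableI.
move=> y /=; rewrite in_itv /= => /andP[ya yb]; split.
  by rewrite /= in_itv /=; apply/andP; split; lra.
move: s1; rewrite /omega_at; set s := Num.sqrt _ => s1.
have s0 : 0 < s by lra.
exists (s^-1 * y); last by rewrite mulVKf ?gt_eqF.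
by left; rewrite /= in_itv /= ler_pdivlMl// ler_pdivrMl//; apply/andP; split; lra.
Qed.

(** * The uniform lower bound *)

Theorem proposition2p5 (R : realType) (mu : R) (hmu : 0 < mu)
    (T : R) (hT : 0 < T) :
  exists r delta : R, [/\ 0 < r, 0 < delta &
    forall x : R,
      (delta%:E <= \int[@lebesgue_measure R]_(t in `[0%R, T])
         @lebesgue_measure R (`](x - r)%R, (x + r)%R[ `&` omega_at mu t))%E].
Proof.
pose S := 1 + 2 * mu * T.
have muT : 0 < mu * T by rewrite mulr_gt0.
have S1 : 1 < S by rewrite /S; lra.
(* The dilation factor at time [T] is [rho ^+ 4], so the points passing [|x|] during [[0, T]] fill
   four consecutive ranges of ratio [rho]; [N] uses the first and [M] the last. *)
pose rho := Num.sqrt (Num.sqrt (Num.sqrt S)).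
have sqrt_gt (a : R) : 1 < a -> 1 < Num.sqrt a.
  by move=> a1; rewrite -[ltLHS]sqrtr1 ltr_sqrt// (lt_trans _ a1).
have rho1 : 1 < rho by rewrite /rho; exact/sqrt_gt/sqrt_gt/sqrt_gt.
have rho8 : rho ^+ 8 = S.
  by rewrite (exprM _ 2 4) sqr_sqrtr ?sqrtr_ge0// (exprM _ 2 2) sqr_sqrtr ?sqrtr_ge0//
    sqr_sqrtr//; lra.
have [Y Y1 sqY] := exists_square_between _ _ rho1.
pose X := rho ^+ 4 * Y.
(* [D] bounds the gap between the passage times of N^2 and M^2 from below, since [|x|] over N^2 is
   at least [rho ^+ 3] and [|x|] over M^2 at most [rho]. *)
pose D := (rho ^+ 6 - rho ^+ 2) / (2 * mu).
have D0 : 0 < D.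
  by rewrite divr_gt0 ?mulr_gt0// subr_gt0 ltr_eXn2l.
have X0 : 0 < X by rewrite mulr_gt0 ?exprn_gt0//; lra.
(* [T] serves [|x| <= X], where the integrand is at least 1 at all times; [D / 3] serves larger
   [|x|]. *)
exists (X + 1), (Num.min T (D / 3)); split; first by lra.
  by rewrite lt_min hT divr_gt0.
move=> x; have [xX|Xx] := leP `|x| X.
  apply: (@le_trans _ _ (@lebesgue_measure R `[0, T]%classic)).
    by rewrite lebesgue_measure_itv /= lte_fin hT -EFinD lee_fin subr0 ge_min lexx.
  apply: le_measure_integral_ge1 => // t /=; rewrite in_itv /= => /andP[t0 _].
  by apply: window_near0_omega_at_ge1 => //; [exact: ltW | rewrite lerD2r].
have x0 : 0 < `|x| := lt_trans X0 Xx.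
have rk k : 0 < rho ^+ k by rewrite exprn_gt0//; lra.
have [N N0 /andP[xN Nx]] : exists2 n : nat, (0 < n)%N &
    `|x| / rho ^+ 4 <= n%:R ^+ 2 <= rho * (`|x| / rho ^+ 4).
  by apply: sqY; rewrite ler_pdivlMr// mulrC ltW.
have [M M0 /andP[xM Mx]] : exists2 n : nat, (0 < n)%N &
    `|x| / rho <= n%:R ^+ 2 <= rho * (`|x| / rho).
  apply: sqY; rewrite ler_pdivlMr ?(rk 1%N)// mulrC; apply: ltW; apply: le_lt_trans Xx.
  by rewrite ler_wpM2r ?(le_trans _ Y1)// ler_eXnr// ltW.
have hr : rho != 0 by rewrite gt_eqF//; lra.
have NM : (N <= M)%N.
  rewrite -(ler_nat R) -(@ler_pXn2r _ 2)// ?nnegrE//.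
  apply: le_trans xM; apply: le_trans Nx _.
  have -> : `|x| / rho = rho ^+ 2 * (rho * (`|x| / rho ^+ 4)) by field.
  rewrite ler_peMl ?mulr_ge0 ?invr_ge0 ?(ltW (rk _)) ?(ltW (rk 1%N))//.
  by rewrite expr_ge1 ?(ltW (rk 1%N))// ltW.
have pos k : (0 < k)%N -> 0 < k%:R ^+ 2 :> R by move=> k0; rewrite exprn_gt0 ?ltr0n.
have tN : rho ^+ 3 <= `|x| / N%:R ^+ 2.
  rewrite ler_pdivlMr ?pos//.
  rewrite [leRHS](_ : _ = rho ^+ 3 * (rho * (`|x| / rho ^+ 4))); last by field.
  by rewrite ler_pM2l.
have tN' : `|x| / N%:R ^+ 2 <= rho ^+ 4.
  by rewrite ler_pdivrMr ?pos// mulrC -ler_pdivrMr.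
have tM : `|x| / M%:R ^+ 2 <= rho.
  by rewrite ler_pdivrMr ?pos// mulrC -ler_pdivrMr ?(rk 1%N).
have tM' : 1 <= `|x| / M%:R ^+ 2.
  by rewrite ler_pdivlMr ?pos// mul1r (le_trans Mx)// mulrC divfK.
have [E [mE lE EP]] := @filled_times R mu `|x| N M hmu N0 NM.
(* The outer bounds [tM'] and [tN'] keep these times inside [[0, T]]; the inner bounds [tN] and [tM]
   give the gap [D] below. *)
have EP' t : E t -> [/\ 0 <= t, t <= T & exists2 n, (0 < n)%N &
    passage_time mu `|x| (n%:R ^+ 2 + n%:R) < t < passage_time mu `|x| (n%:R ^+ 2)].
  move=> /EP[n /andP[Nn nM] nt]; have n0 := leq_trans N0 Nn; split.
  - move: nt => /andP[nt _]; apply: le_trans (ltW nt).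
    apply: (@le_trans _ _ (passage_time mu `|x| (M%:R ^+ 2))).
      by rewrite divr_ge0 ?subr_ge0 ?exprn_ege1 ?mulr_ge0 ?(ltW hmu).
    apply: passage_time_le; [by []|by rewrite ltr_pwDl ?pos|].
    exact: filled_interval_le.
  - move: nt => /andP[_ nt]; apply: (le_trans (ltW nt)).
    apply: (@le_trans _ _ (passage_time mu `|x| (N%:R ^+ 2))).
      apply: passage_time_le; rewrite ?pos//.
      by rewrite lerXn2r ?nnegrE ?ler_nat.
    rewrite ler_pdivrMr ?mulr_gt0// lerBlDl (mulrC T) -/S -rho8 (exprM _ 4 2).
    by rewrite lerXn2r ?nnegrE ?divr_ge0 ?(ltW (rk _)).
  - by exists n.
apply: (@le_trans _ _ (@lebesgue_measure R E)).
  apply: le_trans lE; rewrite lee_fin ge_min; apply/orP; right.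
  rewrite ler_pM2r ?invr_gt0// /D /passage_time -mulrBl.
  rewrite ler_pM2r ?invr_gt0 ?mulr_gt0// (exprM _ 3 2).
  have : (rho ^+ 3) ^+ 2 <= (`|x| / N%:R ^+ 2) ^+ 2.
    by rewrite lerXn2r ?nnegrE ?divr_ge0 ?(ltW (rk _)).
  have : (`|x| / M%:R ^+ 2) ^+ 2 <= rho ^+ 2.
    by rewrite lerXn2r ?nnegrE ?divr_ge0 ?(ltW (rk 1%N)).
  by lra.
apply: le_measure_integral_ge1 => // [t /EP'[t0 tT _]|t /EP'[t0 tT [n n0 nt]]].
  by rewrite /= in_itv /= t0.
apply: (@window_omega_at_ge1 _ _ _ _ _ n) => //; first by lra.
by rewrite -normr_gt0.
Qed.
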